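(* For $k \geq 0$ and $\mathcal{X} \subseteq \mathcal{O}$ let $$Q_k(\mathcal{X}) = \Big( C_k^{-1} + \sum_{u \in \mathcal{X}} \Phi_k^T (I \otimes V_u) \Phi_k \Big)^{-1}$$ be the smoothing error covariance matrix, and let $$f_T(\mathcal{X}) = \sum_{k=0}^{N-1} \theta_k \Big( \operatorname{Tr}[Q_{m+k}(\mathcal{X})] - \operatorname{Tr}[C_{m+k}] \Big), \qquad f_S(\mathcal{X}) = \sum_{k=0}^{N-1} \theta_k \Big( \|Q_{m+k}(\mathcal{X})\| - \|C_{m+k}\| \Big).$$ Let $\widetilde{\mathcal{T}}^\star \in \operatorname{argmin}_{|\mathcal{T}| \leq s} f_T(\mathcal{T})$ and $\widetilde{\mathcal{S}}^\star \in \operatorname{argmin}_{|\mathcal{S}| \leq s} f_S(\mathcal{S})$, and let $\widetilde{\mathcal{T}}_g$ and $\widetilde{\mathcal{S}}_g$ be the $r$-element greedy solutions for $f_T$ and $f_S$ respectively. Then $$f_T(\widetilde{\mathcal{T}}_g) \leq \left(1 - e^{-\tilde{\alpha} r/s}\right) f_T(\widetilde{\mathcal{T}}^\star), \qquad f_S(\widetilde{\mathcal{S}}_g) \leq \left(1 - e^{-r/s}\right)\left[ f_S(\widetilde{\mathcal{S}}^\star) + s \cdot \tilde{\epsilon} \right],$$ for some $\tilde{\alpha} \geq \min_{0 \leq k \leq N-1} \tilde{\alpha}_k$ and some $\tilde{\epsilon} \leq \sum_{k=0}^{N-1} \theta_k \tilde{\epsilon}_k$, where $$\tilde{\alpha}_k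 = \frac{1/\ell_{\max}}{\lambda_{\max}\big[ C_{m+k}^{-1} + \sum_{u \in \mathcal{O}} \Phi_{m+k}^T (I \otimes V_u) \Phi_{m+k} \big]}, \qquad \tilde{\epsilon}_k = \lambda_{\max}\Big[ \sum_{u \in \mathcal{O}} \Phi_{m+k}^T (I \otimes V_u) \Phi_{m+k} \Big]\, \ell_{\max}^2,$$ and $\ell_{\max} = \max[ \lambda_{\max}(\Pi_0), \lambda_{\max}(R_w) ]$.
   Context: System: states $x_k \in \mathbb{R}^n$ evolve as $x_{k+1} = F x_k + w_k$ with $F \in \mathbb{R}^{n \times n}$; $\mathcal{O}$ is a finite set of sensors, and sensor $u \in \mathcal{O}$ outputs $y_{u,k} = H_u x_k + v_{u,k} \in \mathbb{R}^{p_u}$ with $H_u \in \mathbb{R}^{p_u \times n}$. The noises $w_k$ and $v_{u,k}$ are zero-mean Gaussian with covariances $R_w \succ 0$ and $R_{v,u} \succ 0$ and are independent across times and sensors; the initial state is Gaussian with covariance $\Pi_0 \succ 0$. Notation: $V_u = H_u^T R_{v,u}^{-1} H_u$. $C_k = \operatorname{blkdiag}(\Pi_0, I \otimes R_w)$ is the block diagonal matrix with one block $\Pi_0$ followed by $k$ blocks $R_w$ (size $(k+1)n$). $I \otimes V_u$ in the formula for $Q_k$ is block diagonal with $k+1$ blocks $V_u$. $\Phi_k$ is the $(k+1)\times(k+1)$ block lower triangular matrix whose $(i,j)$ block ($0 \leq j \leq i \leq k$) is $F^{i-j}$, with $F^0 = I$, and whose blocks above the diagonal are zero. Parameters: $N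 \geq 1$ and $m \geq 0$ are integers, $\theta_k \geq 0$ for $0 \leq k \leq N-1$, $s \geq 1$ is an integer budget, and $0 \leq r \leq |\mathcal{O}|$ is an integer. Greedy solution with $r$ elements for an objective $f$: $\mathcal{G}_0 = \emptyset$, $\mathcal{G}_{j+1} = \mathcal{G}_j \cup \{u\}$ with $u \in \operatorname{argmin}_{w \in \mathcal{O} \setminus \mathcal{G}_j} f(\mathcal{G}_j \cup \{w\})$ (ties broken arbitrarily); the solution is $\mathcal{G}_r$. $\|\cdot\|$ is the spectral norm; $\lambda_{\min}, \lambda_{\max}$ are the smallest and largest eigenvalues. *)

(* Defs.v *)
From HB Require Import structures.
From mathcomp Require Import all_boot all_order all_algebra.
From mathcomp Require Import all_classical all_reals.

Set Implicit Arguments.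
Unset Strict Implicit.
Unset Printing Implicit Defensive.
Import Order.TTheory GRing.Theory Num.Theory.
Local Open Scope classical_set_scope.
Local Open Scope ring_scope.

Definition posdef (R : realType) (n : nat) (A : 'M[R]_n) : Prop :=
  A^T = A /\ forall x : 'cV[R]_n, x != 0 -> 0 < (x^T *m A *m x) 0 0.

(* Largest eigenvalue.  It is only applied to real symmetric matrices of
   positive size, whose set of eigenvalues is finite and nonempty, so that the
   supremum is attained. *)
Definition lambda_max (R : realType) (n : nat) (A : 'M[R]_n) : R :=
  sup [set a | eigenvalue A a].

(* Spectral norm: the largest singular value. *)
Definition spectral_norm (R : realType) (n : nat) (A : 'M[R]_n) : R :=
  Num.sqrt (lambda_max (A^T *m A)).

Section Smoothing.

Context (R : realType) (n : nat) (O : finType) (p : O -> nat).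
Context (F : 'M[R]_n) (H : forall u : O, 'M[R]_(p u, n)).
Context (Pi0 Rw : 'M[R]_n) (Rv : forall u : O, 'M[R]_(p u)).

(* Covariance of (x_0, w_0, ..., w_{k-1}); the size \sum_(i < k.+1) n is
   (k + 1) n. *)
Definition prior_cov (k : nat) : 'M[R]_(\sum_(i < k.+1) n) :=
  \mxdiag_(i < k.+1) (if (i : nat) == 0%N then Pi0 else Rw).

(* Maps (x_0, w_0, ..., w_{k-1}) to the trajectory (x_0, ..., x_k) of
   x_{i+1} = F x_i + w_i. *)
Definition transition (k : nat) :
    'M[R]_(\sum_(i < k.+1) n, \sum_(j < k.+1) n) :=
  \mxblock_(i < k.+1, j < k.+1)
    (if (j <= i)%N then F ^+ (i - j) else 0 : 'M[R]_n).

Definition sensor_info (u : O) : 'M[R]_n := (H u)^T *m invmx (Rv u) *m H u.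

Definition smoothing_info (k : nat) (X : {set O}) :
    'M[R]_(\sum_(i < k.+1) n) :=
  \sum_(u in X)
    (transition k)^T *m (\mxdiag_(i < k.+1) sensor_info u) *m transition k.

(* Error covariance of the estimate of (x_0, w_0, ..., w_{k-1}) from the outputs
   of the sensors in X at times 0, ..., k. *)
Definition smoothing_cov (k : nat) (X : {set O}) :
    'M[R]_(\sum_(i < k.+1) n) :=
  invmx (invmx (prior_cov k) + smoothing_info k X).

Definition trace_objective (m N : nat) (theta : 'I_N -> R) (X : {set O}) : R :=
  \sum_(k < N) theta k *
    (\tr (smoothing_cov (m + k) X) - \tr (prior_cov (m + k))).

Definition norm_objective (m N : nat) (theta : 'I_N -> R) (X : {set O}) : R :=
  \sum_(k < N) theta k *
    (spectral_norm (smoothing_cov (m + k) X)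
     - spectral_norm (prior_cov (m + k))).

Definition ell_max : R := Num.max (lambda_max Pi0) (lambda_max Rw).

Definition alpha_tilde (m k : nat) : R :=
  ell_max^-1 /
  lambda_max (invmx (prior_cov (m + k)) + smoothing_info (m + k) [set: O]%SET).

Definition epsilon_tilde (m k : nat) : R :=
  lambda_max (smoothing_info (m + k) [set: O]%SET) * ell_max ^+ 2.

(* For 0 < N this is the minimum of alpha_tilde m k over 0 <= k <= N - 1: the
   default value alpha_tilde m 0 is one of the terms. *)
Definition min_alpha_tilde (m N : nat) : R :=
  \big[Num.min/alpha_tilde m 0]_(k < N) alpha_tilde m k.

End Smoothing.

Definition budget_argmin (R : realType) (O : finType) (f : {set O} -> R)
    (s : nat) (X : {set O}) : Prop :=
  (#|X| <= s)%N /\ forall Y : {set O}, (#|Y| <= s)%N -> f X <= f Y.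

(* greedy_solution f j G: G is the j-th iterate of some run of the greedy
   algorithm, ties being broken arbitrarily. *)
Inductive greedy_solution (R : realType) (O : finType) (f : {set O} -> R) :
    nat -> {set O} -> Prop :=
| greedy_zero : greedy_solution f 0 finset.set0
| greedy_step (j : nat) (G : {set O}) (u : O) :
    greedy_solution f j G -> u \notin G ->
    (forall w : O, w \notin G -> f (u |: G)%SET <= f (w |: G)%SET) ->
    greedy_solution f j.+1 (u |: G)%SET.

(* Main.v *)
Require Import Defs.
From mathcomp Require Import all_boot all_order all_algebra.
From mathcomp Require Import all_classical all_reals.
From mathcomp Require Import sequences exp.
From mathcomp Require Import ring lra.

Set Implicit Arguments.
Unset Strict Implicit.
Unset Printing Implicit Defensive.
Import Order.TTheory GRing.Theory Num.Theory.
Local Open Scope ring_scope.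

(** Both objectives satisfy one inequality: for [A \subset B] and [u \notin B],
    [alpha * (gain B u - eps) <= gain A u], where [gain X u = f X - f (u |: X)].
    It holds with [eps = 0] and [alpha] the smallest of the constants [alpha_tilde]
    for the trace, and with [alpha = 1] and [eps] the weighted sum of the
    constants [epsilon_tilde] for the spectral norm. The classical greedy argument
    then applies ([greedy_bound]): adding the elements of a competitor [S] one by
    one to the greedy set [G] shows that the best single element recovers a
    fraction [alpha / s] of the distance from [f G] to [f S + s * eps], so that
    this distance decays at least like [(1 - alpha / s) ^+ r].

    The two inequalities reduce to one horizon, where the information matrix [M]
    of a set of sensors grows in the Loewner order with the set and a sensor adds
    a positive semidefinite [V]. Write [D M = invmx M - invmx (M + V)], which is
    positive semidefinite.

    Trace ([trace_gain]): [D M *m M = invmx (M + V) *m V], whose trace decreases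
    when [M] grows, because the trace of a product of two positive semidefinite
    matrices is nonnegative ([mxtrace_mul_psd]). Bounding [M] between [l%:M] and
    [L%:M] turns [\tr (D M *m M)] into [\tr (D M)], at the cost of the factor
    [l / L].

    Norm ([inv_loewner_add]): the gain at [A] is nonnegative, so it is enough that
    the gain at [B] is at most [eps], and indeed, with [P = invmx M],
    [D M ≼ P *m V *m P ≼ c *: (P *m P) ≼ (c * l ^+ 2)%:M] as soon as [V ≼ c%:M]
    and [P ≼ l%:M].

    Eigenvalues enter through a single fact: the largest eigenvalue of a positive
    semidefinite matrix is the least [c] such that [A ≼ c%:M] ([lambda_max_psd],
    [lambda_max_le]). It is obtained without compactness or a spectral theorem,
    from the antitonicity of the inverse ([loewner_inv]). *)

(** * Quadratic forms and positive semidefinite matrices *)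

Section Quad.
Context {R : realType}.

Definition quad (n : nat) (A : 'M[R]_n) (x : 'cV[R]_n) : R :=
  (x^T *m A *m x) 0 0.

Definition psd (n : nat) (A : 'M[R]_n) : Prop :=
  A^T = A /\ forall x, 0 <= quad A x.

Lemma quadD n (A B : 'M[R]_n) x : quad (A + B) x = quad A x + quad B x.
Proof. by rewrite /quad mulmxDr mulmxDl mxE. Qed.

Lemma quadN n (A : 'M[R]_n) x : quad (- A) x = - quad A x.
Proof. by rewrite /quad mulmxN mulNmx mxE. Qed.

Lemma quadB n (A B : 'M[R]_n) x : quad (A - B) x = quad A x - quad B x.
Proof. by rewrite quadD quadN. Qed.

Lemma quadZ n a (A : 'M[R]_n) x : quad (a *: A) x = a * quad A x.
Proof. by rewrite /quad -scalemxAr -scalemxAl mxE. Qed.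

Lemma quad_scalar n a (x : 'cV[R]_n) : quad a%:M x = a * quad 1%:M x.
Proof. by rewrite -[a%:M]scalemx1 quadZ. Qed.

Lemma quad_congr m n (A : 'M[R]_m) (S : 'M[R]_(m, n)) x :
  quad (S^T *m A *m S) x = quad A (S *m x).
Proof. by rewrite /quad trmx_mul !mulmxA. Qed.

Lemma quad0 n (A : 'M[R]_n) : quad A 0 = 0.
Proof. by rewrite /quad mulmx0 mxE. Qed.

Lemma quad_delta n (A : 'M[R]_n) i : quad A (delta_mx i 0) = A i i.
Proof. by rewrite /quad trmx_delta -rowE -colE !mxE. Qed.

Lemma quad1_sum n (x : 'cV[R]_n) : quad 1%:M x = \sum_i x i 0 ^+ 2.
Proof.
by rewrite /quad mulmx1 mxE; apply: eq_bigr => i _; rewrite mxE -expr2.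
Qed.

Lemma bilin_sym n (A : 'M[R]_n) (x y : 'cV[R]_n) :
  A^T = A -> (x^T *m A *m y) 0 0 = (y^T *m A *m x) 0 0.
Proof.
move=> sA; transitivity ((x^T *m A *m y)^T 0 0); first by rewrite [RHS]mxE.
by rewrite !trmx_mul trmxK sA mulmxA.
Qed.

Lemma quad_addv n (A : 'M[R]_n) (x y : 'cV[R]_n) a : A^T = A ->
  quad A (x + a *: y) = quad A x + 2 * a * (y^T *m A *m x) 0 0 + a ^+ 2 * quad A y.
Proof.
move=> sA; rewrite /quad; have -> : (x + a *: y)^T = x^T + a *: y^T by rewrite !linearE.
rewrite !mulmxDr !mulmxDl.
rewrite -!(scalemxAl, scalemxAr); move: (bilin_sym x y sA).
move: (x^T *m A *m x) (x^T *m A *m y) (y^T *m A *m x) (y^T *m A *m y).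
by move=> p q r t qr; rewrite !mxE qr; ring.
Qed.

Lemma posdef1 n : posdef (1%:M : 'M[R]_n).
Proof.
split; first exact: trmx1.
move=> x x0; rewrite -/(quad _ _) quad1_sum lt_neqAle eq_sym.
rewrite sumr_ge0 => [|i _]; last exact: sqr_ge0.
rewrite andbT psumr_eq0 => [|i _]; last exact: sqr_ge0.
apply: contra x0 => /allP x0; apply/eqP/matrixP => i j; rewrite ord1 mxE.
by apply/eqP; rewrite -sqrf_eq0; apply: x0; rewrite mem_index_enum.
Qed.

Lemma posdef_quad n (A : 'M[R]_n) x : posdef A -> x != 0 -> 0 < quad A x.
Proof. by move=> [_]; apply. Qed.

Lemma posdef_psd n (A : 'M[R]_n) : posdef A -> psd A.
Proof.
move=> [sA pA]; split=> // x; have [->|/pA/ltW//] := eqVneq x 0.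
by rewrite quad0.
Qed.

Lemma psd0 n : psd (0 : 'M[R]_n).
Proof. by split=> [|x]; rewrite ?trmx0 // /quad mulmx0 mul0mx mxE. Qed.

Lemma psdD n (A B : 'M[R]_n) : psd A -> psd B -> psd (A + B).
Proof.
move=> [sA pA] [sB pB]; split=> [|x]; first by rewrite linearD /= sA sB.
by rewrite quadD addr_ge0.
Qed.

Lemma psd_sum n (I : finType) (P : pred I) (A : I -> 'M[R]_n) :
  (forall i, P i -> psd (A i)) -> psd (\sum_(i | P i) A i).
Proof. by move=> pA; apply: big_ind => //; [exact: psd0 | exact: psdD]. Qed.

Lemma psdZ n a (A : 'M[R]_n) : 0 <= a -> psd A -> psd (a *: A).
Proof.
move=> a0 [sA pA]; split=> [|x]; first by rewrite linearZ /= sA.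
by rewrite quadZ mulr_ge0.
Qed.

Lemma psd_scalar n a : 0 <= a -> psd (a%:M : 'M[R]_n).
Proof.
move=> a0; rewrite -[a%:M]scalemx1; apply: psdZ => //.
exact/posdef_psd/posdef1.
Qed.

Lemma posdef_scalar n a : 0 < a -> posdef (a%:M : 'M[R]_n).
Proof.
move=> a0; split=> [|x x0]; first by rewrite tr_scalar_mx.
by rewrite -/(quad _ _) quad_scalar mulr_gt0 // posdef_quad //; apply: posdef1.
Qed.

Lemma psd_congr m n (A : 'M[R]_m) (S : 'M[R]_(m, n)) :
  psd A -> psd (S^T *m A *m S).
Proof.
move=> [sA pA]; split=> [|x]; last by rewrite quad_congr.
by rewrite !trmx_mul trmxK sA mulmxA.
Qed.

Lemma psd_sandwich n (A B : 'M[R]_n) : A^T = A -> psd B -> psd (A *m B *m A).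
Proof. by move=> {1}<-; apply: psd_congr. Qed.

Lemma posdefD n (A B : 'M[R]_n) : posdef A -> psd B -> posdef (A + B).
Proof.
move=> [sA pA] [sB pB]; split=> [|x x0]; first by rewrite linearD /= sA sB.
by rewrite -/(quad _ _) quadD ltr_wpDr // pA.
Qed.

Lemma psd_diag_ge0 n (A : 'M[R]_n) i : psd A -> 0 <= A i i.
Proof. by move=> [_ pA]; rewrite -quad_delta. Qed.

End Quad.

(** * The Loewner order *)

Definition loewner (R : realType) (n : nat) (A B : 'M[R]_n) : Prop := psd (B - A).

Notation "A ≼ B" := (loewner A B) (at level 70, no associativity) : ring_scope.

Section Loewner.
Context {R : realType} {n : nat}.
Implicit Types (A B C V : 'M[R]_n).

Lemma loewner_quad A B x : A ≼ B -> quad A x <= quad B x.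
Proof. by move=> [_ /(_ x)]; rewrite quadB subr_ge0. Qed.

Lemma loewner_trans B A C : A ≼ B -> B ≼ C -> A ≼ C.
Proof. by move=> AB BC; have := psdD BC AB; rewrite addrA subrK. Qed.

Lemma loewner_addr A V : psd V -> A ≼ A + V.
Proof. by move=> pV; rewrite /loewner addrC addKr. Qed.

Lemma loewner_add A B C V : A ≼ B -> C ≼ V -> A + C ≼ B + V.
Proof.
move=> AB CV; have := psdD AB CV; congr psd.
by rewrite opprD addrACA.
Qed.

Lemma loewner_scalar a b : a <= b -> (a%:M : 'M[R]_n) ≼ b%:M.
Proof.
move=> ab; have := @psd_scalar R n (b - a); rewrite subr_ge0 => /(_ ab).
by rewrite raddfB.
Qed.

Lemma loewner_scalarP A c : A^T = A ->
  A ≼ c%:M <-> forall x, quad A x <= c * quad 1%:M x.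
Proof.
move=> sA; split=> [Ac x|Ac]; first by rewrite -quad_scalar loewner_quad.
split=> [|x]; first by rewrite linearB /= tr_scalar_mx sA.
by rewrite quadB quad_scalar subr_ge0.
Qed.

Lemma posdef_unitmx A : posdef A -> A \in unitmx.
Proof.
move=> [sA pA]; rewrite -row_free_unit -kermx_eq0; apply/contraT => /rowV0Pn[v].
move=> /sub_kermxP vA v0; have := pA v^T; rewrite trmxK vA mul0mx mxE ltxx.
by apply; rewrite trmx_eq0.
Qed.

Lemma posdef_inv A : posdef A -> posdef (invmx A).
Proof.
move=> pA; have uA := posdef_unitmx pA; have [sA qA] := pA.
split=> [|x x0]; first by rewrite trmx_inv sA.
have -> : invmx A = (invmx A)^T *m A *m invmx A.
  by rewrite trmx_inv sA mulVmx // mul1mx.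
rewrite -/(quad _ _) quad_congr; apply: qA; apply: contra x0 => /eqP Ax0.
by rewrite -[x](mulKVmx uA) Ax0 mulmx0.
Qed.

(** Moving from [x] in the direction [- A *m x] would make the quadratic form
    negative, were [A *m x] nonzero. *)
Lemma psd_quad_eq0 A x : psd A -> quad A x = 0 -> A *m x = 0.
Proof.
move=> [sA pA] qx0; apply/eqP; apply: contraT => Ax0.
have w0 : 0 < quad 1%:M (A *m x) by apply: posdef_quad Ax0; exact: posdef1.
(* A step small enough for the first-order decrease to dominate. *)
pose t := (1 + quad A (A *m x))^-1.
have d0 : 0 < 1 + quad A (A *m x) by rewrite ltr_pwDl.
have t0 : 0 < t by rewrite invr_gt0.
have tq : t * quad A (A *m x) <= 1.
  by rewrite mulrC ler_pdivrMr // mul1r lerDr.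
have := pA (x + (- (t * quad 1%:M (A *m x))) *: (A *m x)).
rewrite quad_addv // qx0 -mulmxA -[(_ *m (A *m x)) 0 0]/(((A *m x)^T *m (A *m x)) 0 0).
rewrite -[(A *m x)^T in X in X -> _]mulmx1 -/(quad 1%:M (A *m x)).
move: w0 tq t0; set w := quad 1%:M _; set q := quad A _ => w0 tq t0.
have : t * w ^+ 2 * (t * q) <= t * w ^+ 2 * 1
  by rewrite ler_pM2l // mulr_gt0 // exprn_gt0.
have : 0 < t * w ^+ 2 by rewrite mulr_gt0 // exprn_gt0.
nra.
Qed.

Lemma psd_unit_posdef A : psd A -> A \in unitmx -> posdef A.
Proof.
move=> pA uA; have [sA qA] := pA; split=> // x x0.
rewrite -/(quad _ _) lt_neqAle qA andbT eq_sym.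
apply: contra x0 => /eqP /(psd_quad_eq0 pA) Ax0.
by rewrite -[x](mulKmx uA) Ax0 mulmx0.
Qed.

(** The difference of the inverses is an explicit sum of two congruences of
    positive semidefinite matrices, which makes the claim an identity. *)
Lemma loewner_inv A B : posdef A -> A ≼ B -> invmx B ≼ invmx A.
Proof.
move=> pA AB; have pB : posdef B by have := posdefD pA AB; rewrite addrC subrK.
have [uA uB] := (posdef_unitmx pA, posdef_unitmx pB).
have [[siA _] [siB _]] := (posdef_inv pA, posdef_inv pB).
rewrite /loewner.
have -> : invmx A - invmx B = (invmx A - invmx B) *m A *m (invmx A - invmx B)
                              + invmx B *m (B - A) *m invmx B.
  rewrite !(mulmxBl, mulmxBr) mulVmx // mulVmx // !mul1mx.
  by rewrite -(mulmxA _ A (invmx A)) mulmxV // mulmx1 subrK.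
apply: psdD; apply: psd_sandwich => //.
  by rewrite linearB /= siA siB.
exact: posdef_psd.
Qed.

End Loewner.

(** * Traces of products of positive semidefinite matrices *)

Section Trace.
Context {R : realType} {n : nat}.
Implicit Types (A B C V P Q : 'M[R]_n).

Lemma quad_outer (y x : 'cV[R]_n) : quad (y *m y^T) x = (y^T *m x) 0 0 ^+ 2.
Proof.
rewrite /quad mulmxA -mulmxA mxE big_ord1 expr2; congr (_ * _).
transitivity ((x^T *m y)^T 0 0); first by rewrite [RHS]mxE.
by rewrite trmx_mul trmxK.
Qed.

(** This is the Cauchy-Schwarz inequality for the form of [A]; the proof evaluates
    the form at [x] minus its [A]-projection onto [y]. *)
Lemma psd_deflate A y : psd A -> 0 < quad A y ->
  psd (A - (quad A y)^-1 *: ((A *m y) *m (A *m y)^T)).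
Proof.
move=> [sA pA] qy; split=> [|x].
  by rewrite linearB linearZ /= [in LHS]trmx_mul trmxK sA.
have := pA (x + (- ((y^T *m A *m x) 0 0 / quad A y)) *: y).
rewrite quad_addv // quadB quadZ quad_outer trmx_mul sA.
move: qy; set q := quad A y; set p := (_ *m x) 0 0 => q0.
suff -> : quad A x + 2 * - (p / q) * p + (- (p / q)) ^+ 2 * q
          = quad A x - q^-1 * p ^+ 2 by [].
by field; rewrite gt_eqF.
Qed.

Lemma psd_diag0 A : psd A -> (forall i, A i i = 0) -> A = 0.
Proof.
move=> pA d0; apply/matrixP => i j; rewrite [RHS]mxE.
have : A *m (delta_mx j 0 : 'cV[R]_n) = 0
  by apply: psd_quad_eq0 => //; rewrite quad_delta.
by rewrite -colE => /matrixP /(_ i 0); rewrite !mxE.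
Qed.

Lemma mxtrace_outer P (y : 'cV[R]_n) : \tr (P *m (y *m y^T)) = quad P y.
Proof. by rewrite mulmxA mxtrace_mulC mulmxA trace_mx11. Qed.

(** Deflating [A] along a coordinate vector splits off a rank-one term, on which the
    trace is a value of the form of [P], and kills one diagonal entry without
    reviving any other. So the induction is on the number of nonzero diagonal
    entries, and a matrix with none is zero. *)
Lemma mxtrace_mul_psd P A : psd P -> psd A -> 0 <= \tr (P *m A).
Proof.
move=> pP; have [d] := ubnP #|[set i | A i i != 0]|.
elim: d A => // d IH A /ltnSE le_d pA.
have [[i Aii]|] := pselect (exists i, A i i != 0); last first.
  move=> /forallNP d0; rewrite (psd_diag0 pA) ?mulmx0 ?mxtrace0 // => i.
  by apply/eqP/negPn/negP/d0.
pose y : 'cV[R]_n := delta_mx i 0.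
have qy : quad A y = A i i by exact: quad_delta.
have Aii0 : 0 < quad A y by rewrite qy lt_neqAle eq_sym Aii psd_diag_ge0.
have pA' := psd_deflate pA Aii0; set A' := (_ - _) in pA'.
have A'E j : A' j j = A j j - (A i i)^-1 * A j i ^+ 2.
  by rewrite /A' qy -colE !mxE big_ord1 !mxE expr2.
have -> : \tr (P *m A) = \tr (P *m A') + (quad A y)^-1 * quad P (A *m y).
  by rewrite -(mxtrace_outer P) -mxtraceZ scalemxAr -mxtraceD -mulmxDr subrK.
apply: addr_ge0; last by rewrite mulr_ge0 ?invr_ge0 ?(ltW Aii0) //; case: pP.
apply: IH => //; apply: leq_trans le_d; apply: proper_card; apply/properP.
split.
  apply/fintype.subsetP => j; rewrite !inE; apply: contra => /eqP Ajj.
  rewrite eq_le psd_diag_ge0 // andbT A'E Ajj sub0r oppr_le0.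
  by rewrite mulr_ge0 ?sqr_ge0 // invr_ge0 psd_diag_ge0.
exists i; rewrite inE // negbK A'E expr2 mulKf ?subrr //.
Qed.

Lemma mxtrace_loewner A B : A ≼ B -> \tr A <= \tr B.
Proof.
move=> AB; have := mxtrace_mul_psd (posdef_psd (posdef1 n)) AB.
by rewrite mul1mx linearB subr_ge0.
Qed.

(** The inequality [quad A x <= \tr A * quad 1%:M x] is the nonnegativity of the
    trace of [A] times the projection orthogonal to [x]. *)
Lemma psd_le_trace A : psd A -> A ≼ (\tr A)%:M.
Proof.
move=> pA; have sA : A^T = A by case: pA.
apply/loewner_scalarP => // x; have [->|x0] := eqVneq x 0.
  by rewrite !quad0 mulr0.
have qx : 0 < quad 1%:M x by apply: posdef_quad x0; exact: posdef1.
have := mxtrace_mul_psd pA (psd_deflate (posdef_psd (posdef1 n)) qx).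
rewrite mulmxBr linearB /= mulmx1 -scalemxAr mxtraceZ mxtrace_outer mul1mx.
by rewrite subr_ge0 mulrC ler_pdivrMr.
Qed.

End Trace.

(** * Largest eigenvalue and spectral norm *)

Section LambdaMax.
Context {R : realType} {n : nat}.
Hypothesis n_gt0 : (0 < n)%N.
Implicit Types (A B C V P Q : 'M[R]_n).

Lemma unit_vector : exists x : 'cV[R]_n, quad 1%:M x = 1.
Proof.
by exists (delta_mx (Ordinal n_gt0) 0); rewrite quad_delta mxE eqxx.
Qed.

Lemma loewner_scalar_le a b : (a%:M : 'M[R]_n) ≼ b%:M -> a <= b.
Proof.
have [x x1] := unit_vector; move=> ab; have := loewner_quad x ab.
by rewrite quad_scalar [leRHS]quad_scalar x1 !mulr1.
Qed.

(** Let [c] be the infimum of the scalars whose multiple of the identity dominates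
    [A]. Then [c%:M - A] is positive semidefinite. Were it invertible, its inverse
    would be dominated by some [K%:M], hence it would itself dominate [K^-1%:M],
    and [c - K^-1] would be a smaller such scalar. So [c%:M - A] is singular and
    [c] is an eigenvalue; the others are below it, by evaluation of the forms at an
    eigenvector. *)
Lemma lambda_max_psd A : psd A ->
  eigenvalue A (lambda_max A) /\ A ≼ (lambda_max A)%:M.
Proof.
move=> pA; have sA : A^T = A by case: pA.
pose E : set R := [set c : R | A ≼ c%:M]%classic.
have E0 : (E !=set0)%classic by exists (\tr A); exact: psd_le_trace.
have lbE : has_lbound E.
  exists 0 => c Ec; apply: loewner_scalar_le; apply: loewner_trans Ec.
  by rewrite /loewner raddf0 subr0.
have AI : A ≼ (inf E)%:M.
  apply/loewner_scalarP => // x; have [->|x0] := eqVneq x 0.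
    by rewrite !quad0 mulr0.
  have qx : 0 < quad 1%:M x by apply: posdef_quad x0; exact: posdef1.
  rewrite -ler_pdivrMr //; apply: lb_le_inf => // c /loewner_scalarP.
  by move=> /(_ sA x); rewrite ler_pdivrMr.
have eigI : eigenvalue A (inf E).
  rewrite /eigenvalue /eigenspace kermx_eq0 row_free_unit; apply/negP.
  rewrite -opprB -scaleN1r unitmxZ ?unitrN1 // => uI; have pI := psd_unit_posdef AI uI.
  pose K := \tr (invmx ((inf E)%:M - A)).
  have IK : invmx ((inf E)%:M - A) ≼ K%:M.
    exact/psd_le_trace/posdef_psd/posdef_inv.
  have K0 : 0 < K.
    have [x x1] := unit_vector.
    have x0 : x != 0 by apply: contra_eqN x1 => /eqP->; rewrite quad0 eq_sym oner_eq0.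
    have := loewner_quad x IK; rewrite quad_scalar x1 mulr1; apply: lt_le_trans.
    by apply: posdef_quad x0; exact: posdef_inv.
  have := loewner_inv (posdef_inv pI) IK; rewrite invmxK invmx_scalar => KI.
  have : inf E <= inf E - K^-1.
    apply: ge_inf => //; move: KI; rewrite /E /= /loewner; congr psd.
    by rewrite raddfB /= addrAC.
  by rewrite lerDl oppr_ge0 invr_le0 leNgt K0.
suff -> : lambda_max A = inf E by [].
have ubI : ubound [set a | eigenvalue A a]%classic (inf E).
  move=> a /eigenvalueP[v vA v0]; have v0' : v^T != 0 by rewrite trmx_eq0.
  have := loewner_quad v^T AI; rewrite quad_scalar.
  have -> : quad A v^T = a * quad 1%:M v^T.
    by rewrite /quad trmxK vA -scalemxAl mulmx1 mxE.
  by rewrite ler_pM2r //; apply: posdef_quad v0'; exact: posdef1.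
apply/eqP; rewrite eq_le; apply/andP; split.
  by apply: ge_sup ubI; exists (inf E).
by apply: ub_le_sup eigI; exists (inf E).
Qed.

Lemma loewner_lambda_max A : psd A -> A ≼ (lambda_max A)%:M.
Proof. by move=> /lambda_max_psd[]. Qed.

Lemma lambda_max_le A c : psd A -> A ≼ c%:M -> lambda_max A <= c.
Proof.
move=> pA Ac; have [/eigenvalueP[v vA v0] _] := lambda_max_psd pA.
have v0' : v^T != 0 by rewrite trmx_eq0.
have := loewner_quad v^T Ac; rewrite quad_scalar.
have -> : quad A v^T = lambda_max A * quad 1%:M v^T.
  by rewrite /quad trmxK vA -scalemxAl mulmx1 mxE.
by rewrite ler_pM2r //; apply: posdef_quad v0'; exact: posdef1.
Qed.

Lemma lambda_max_ge c A : psd A -> c%:M ≼ A -> c <= lambda_max A.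
Proof.
move=> pA cA; apply: loewner_scalar_le.
exact: loewner_trans cA (loewner_lambda_max pA).
Qed.

Lemma lambda_max_ge0 A : psd A -> 0 <= lambda_max A.
Proof. by move=> pA; apply: lambda_max_ge => //; rewrite /loewner raddf0 subr0. Qed.

Lemma lambda_max_gt0 A : posdef A -> 0 < lambda_max A.
Proof.
move=> pA; have [x x1] := unit_vector.
have x0 : x != 0 by apply: contra_eqN x1 => /eqP->; rewrite quad0 eq_sym oner_eq0.
have := loewner_quad x (loewner_lambda_max (posdef_psd pA)).
by rewrite quad_scalar x1 mulr1; apply: lt_le_trans; apply: posdef_quad.
Qed.

(** All the factors commute: [l *: A - A *m A] is [l^-1] times the sum of
    [A *m (l%:M - A) *m A] and [(l%:M - A) *m A *m (l%:M - A)], and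
    [(l ^+ 2)%:M - A *m A] is this matrix plus [l *: (l%:M - A)]. *)
Lemma loewner_mul_self A l : 0 < l -> psd A -> A ≼ l%:M -> A *m A ≼ (l ^+ 2)%:M.
Proof.
move=> l0 pA Al; have sA : A^T = A by case: pA.
have sD : (l%:M - A)^T = l%:M - A by case: Al.
have H1 : psd (l *: A - A *m A).
  have := psdZ (ltW (_ : 0 < l^-1)) (psdD (psd_sandwich sA Al) (psd_sandwich sD pA)).
  rewrite invr_gt0 => /(_ l0); congr psd.
  rewrite !(mulmxBl, mulmxBr, mul_scalar_mx, mul_mx_scalar) -!(scalemxAl, scalemxAr).
  rewrite -!mulmxA; move: (A *m (A *m A)) (A *m A) => X Y.
  by apply/matrixP => i j; rewrite !mxE; field; rewrite gt_eqF.
have := psdD (psdZ (ltW l0) Al) H1; rewrite /loewner; congr psd.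
by rewrite scalerBr scale_scalar_mx -expr2 addrA subrK.
Qed.

Lemma spectral_norm_posdef A : posdef A -> spectral_norm A = lambda_max A.
Proof.
move=> pdA; have pA := posdef_psd pdA; have sA : A^T = A by case: pA.
have pAA : psd (A *m A).
  by have := psd_congr A (posdef_psd (posdef1 n)); rewrite mulmx1 sA.
rewrite /spectral_norm sA; set l := lambda_max A.
have l_gt0 : 0 < l by exact: lambda_max_gt0.
suff -> : lambda_max (A *m A) = l ^+ 2 by rewrite sqrtr_sqr gtr0_norm.
apply/eqP; rewrite eq_le; apply/andP; split.
  by apply: lambda_max_le => //; apply: loewner_mul_self => //; apply: loewner_lambda_max.
have [/eigenvalueP[v vA v0] _] := lambda_max_psd pA.
have v0' : v^T != 0 by rewrite trmx_eq0.
have := loewner_quad v^T (loewner_lambda_max pAA); rewrite quad_scalar.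
have -> : quad (A *m A) v^T = l ^+ 2 * quad 1%:M v^T.
  rewrite /quad trmxK mulmxA vA -scalemxAl vA scalerA -scalemxAl mulmx1 mxE.
  by rewrite expr2.
by rewrite ler_pM2r //; apply: posdef_quad v0'; exact: posdef1.
Qed.
End LambdaMax.

(** * Block diagonal matrices *)

Section BlockDiagonal.
Context {R : realType} {k : nat} {d : 'I_k -> nat}.
Implicit Types (B : forall i, 'M[R]_(d i)).

Lemma quad_mxdiag B x : quad (\mxdiag_i B i) x = \sum_i quad (B i) (submxcol x i).
Proof.
rewrite /quad -[in LHS](submxcolK x) tr_mxcol mul_mxrow_mxdiag mul_mxrow_mxcol.
by rewrite summxE.
Qed.

Lemma psd_mxdiag B : (forall i, psd (B i)) -> psd (\mxdiag_i B i).
Proof.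
move=> pB; split=> [|x].
  by rewrite tr_mxdiag; apply: eq_mxdiag => i; case: (pB i).
by rewrite quad_mxdiag sumr_ge0 // => i _; case: (pB i).
Qed.

Lemma posdef_mxdiag B : (forall i, posdef (B i)) -> posdef (\mxdiag_i B i).
Proof.
move=> pB; have [sB qB] := psd_mxdiag (fun i => posdef_psd (pB i)).
split=> // x x0; rewrite -/(quad _ _) quad_mxdiag.
rewrite lt_neqAle sumr_ge0 ?andbT => [|i _]; last by have [_] := posdef_psd (pB i).
rewrite eq_sym psumr_eq0 => [|i _]; last by have [_] := posdef_psd (pB i).
apply: contra x0 => /allP x0; rewrite -[x]submxcolK; apply/eqP.
rewrite -[RHS](mxcol0 (p_ := d)); apply: eq_mxcol => i.
apply/eqP/negPn/negP => /(posdef_quad (pB i)).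
by rewrite (eqP (x0 i _)) ?ltxx // mem_index_enum.
Qed.

Lemma mxdiag_loewner_scalar B l : (forall i, B i ≼ l%:M) -> \mxdiag_i B i ≼ l%:M.
Proof.
move=> Bl; rewrite /loewner -mxdiagZ -mxdiagB; exact: psd_mxdiag.
Qed.

End BlockDiagonal.

(** * Decrease of the inverse under a positive semidefinite update *)

Section Gains.
Context {R : realType} {n : nat}.
Implicit Types (A B M V : 'M[R]_n).

(** Multiplying the gain by [M] leaves only one inverse, so that its trace is
    monotone in [M], which the trace of the gain itself need not be. *)
Lemma mul_inv_gain M V : posdef M -> psd V ->
  (invmx M - invmx (M + V)) *m M = invmx (M + V) *m V.
Proof.
move=> pM pV; have [uM uMV] := (posdef_unitmx pM, posdef_unitmx (posdefD pM pV)).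
rewrite mulmxBl mulVmx // -{1}(mulVmx uMV) mulmxDr.
by rewrite addrC addKr.
Qed.

(** The trace of [(invmx M - invmx (M + V)) *m M] separates the two sides: at [B]
    it is at least [l] times the gain, at [A] at most [L] times the gain, and it
    decreases from [A] to [B]. *)
Lemma trace_gain A B V l L : posdef A -> A ≼ B -> psd V ->
  A ≼ L%:M -> l%:M ≼ B ->
  l * (\tr (invmx B) - \tr (invmx (B + V)))
    <= L * (\tr (invmx A) - \tr (invmx (A + V))).
Proof.
move=> pA AB pV AL lB.
have pB : posdef B by have := posdefD pA AB; rewrite addrC subrK.
have gain_psd M : posdef M -> psd (invmx M - invmx (M + V)).
  by move=> pM; apply: loewner_inv => //; apply: loewner_addr.
pose t M := \tr (invmx (M + V) *m V).
have gainE M : posdef M -> \tr ((invmx M - invmx (M + V)) *m M) = t M.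
  by move=> pM; rewrite mul_inv_gain.
have upper : l * (\tr (invmx B) - \tr (invmx (B + V))) <= t B.
  have := mxtrace_mul_psd (gain_psd _ pB) lB.
  by rewrite mulmxBr linearB /= gainE // mul_mx_scalar mxtraceZ linearB subr_ge0.
have lower : t A <= L * (\tr (invmx A) - \tr (invmx (A + V))).
  have := mxtrace_mul_psd (gain_psd _ pA) AL.
  by rewrite mulmxBr linearB /= gainE // mul_mx_scalar mxtraceZ linearB subr_ge0.
apply: le_trans upper (le_trans _ lower).
have AVBV : A + V ≼ B + V by rewrite /loewner opprD addrACA subrr addr0.
have := mxtrace_mul_psd (loewner_inv (posdefD pA pV) AVBV) pV.
by rewrite mulmxBl linearB subr_ge0.
Qed.

(** The gain is at most its first-order expansion [P *m V *m P] with
    [P = invmx M]: the defect [P *m V *m invmx (M + V) *m V *m P] is a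
    congruence. *)
Lemma inv_loewner_add M V c l : posdef M -> psd V -> V ≼ c%:M -> 0 <= c ->
  0 < l -> invmx M ≼ l%:M -> invmx M ≼ invmx (M + V) + (c * l ^+ 2)%:M.
Proof.
move=> pM pV Vc c0 l0 Ml; have pP := posdef_inv pM.
have uMV := posdef_unitmx (posdefD pM pV).
have uM := posdef_unitmx pM.
have [sP sV] : (invmx M)^T = invmx M /\ V^T = V by case: pP; case: pV.
have gainE : invmx M - invmx (M + V) = invmx M *m V *m invmx (M + V).
  have {1}-> : invmx M = invmx M *m (M + V) *m invmx (M + V) by rewrite mulmxK.
  by rewrite mulmxDr mulVmx // mulmxDl mul1mx addrC addKr.
have gainE' : invmx M - invmx (M + V) = invmx (M + V) *m V *m invmx M.
  by rewrite -mul_inv_gain // -mulmxA mulmxV // mulmx1.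
have H1 : invmx M - invmx (M + V) ≼ invmx M *m V *m invmx M.
  have -> : invmx M - invmx (M + V) = invmx M *m V *m invmx (M + V) by [].
  rewrite /loewner -mulmxBr gainE' !mulmxA.
  have := psd_congr (V *m invmx M) (posdef_psd (posdef_inv (posdefD pM pV))).
  by rewrite trmx_mul sP sV !mulmxA.
have H2 : invmx M *m V *m invmx M ≼ c *: (invmx M *m invmx M).
  have := psd_sandwich sP Vc; rewrite /loewner; congr psd.
  by rewrite mulmxBr mulmxBl mul_mx_scalar -scalemxAl.
have H3 : c *: (invmx M *m invmx M) ≼ (c * l ^+ 2)%:M.
  have := psdZ c0 (loewner_mul_self l0 (posdef_psd pP) Ml).
  by rewrite /loewner; congr psd; rewrite scalerBr scale_scalar_mx.
have := loewner_trans H1 (loewner_trans H2 H3).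
by rewrite /loewner; congr psd; rewrite opprB addrA (addrC (c * _)%:M).
Qed.

End Gains.

(** * Greedy minimization of approximately supermodular functions *)

Section Greedy.
Context {R : realType} {O : finType}.
Variables (f : {set O} -> R) (alpha eps : R).
Hypothesis f0 : f finset.set0 = 0.
Hypothesis f_anti : forall (A : {set O}) u, f (u |: A)%SET <= f A.
Hypothesis gain : forall (A B : {set O}) u, A \subset B -> u \notin B ->
  alpha * (f B - f (u |: B)%SET - eps) <= f A - f (u |: A)%SET.
Hypothesis alpha01 : 0 <= alpha <= 1.
Hypothesis eps_ge0 : 0 <= eps.

Lemma f_setU (l : seq O) A : f ([set:: l]%SET :|: A) <= f A.
Proof.
elim: l => [|u l IH]; first by rewrite finset.set_nil finset.set0U.
by rewrite finset.set_cons -finset.setUA; apply: le_trans IH.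
Qed.

(** For each element of [l] added on top of [G], [alpha] times the decrease of [f],
    less [eps], is at most what the element gains at [G], hence at most the greedy
    gain; an element already present changes nothing, and is harmless as the greedy
    gain and [eps] are nonnegative. *)
Lemma greedy_step_seq (G : {set O}) u (l : seq O) :
  (forall w, w \notin G -> f (u |: G)%SET <= f (w |: G)%SET) ->
  alpha * (f G - f ([set:: l]%SET :|: G) - (size l)%:R * eps)
    <= (size l)%:R * (f G - f (u |: G)%SET).
Proof.
have [a0 a1] := andP alpha01.
move=> minu; have g0 : 0 <= f G - f (u |: G)%SET by rewrite subr_ge0.
elim: l => [|w l IH]; first
  by rewrite finset.set_nil finset.set0U subrr !mul0r subr0 mulr0.
rewrite finset.set_cons -finset.setUA; set B := _ :|: G in IH *.
have ae : 0 <= alpha * eps by rewrite mulr_ge0.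
suff step : alpha * (f B - f (w |: B)%SET - eps) <= f G - f (u |: G)%SET.
  by rewrite /= -natr1; move: IH step; set k := _%:R; nra.
have [wB|wB] := boolP (w \in B).
  have -> : (w |: B)%SET = B by apply/finset.setUidPr; rewrite finset.sub1set.
  by rewrite subrr sub0r mulrN (le_trans _ g0) // oppr_le0.
have wG : w \notin G by apply: contra wB; rewrite finset.in_setU orbC => ->.
apply: le_trans (gain _ wB) _; first exact: finset.subsetUr.
by rewrite lerD2l lerN2 minu.
Qed.

(** The distance to [Y = f S + s * eps] contracts by [1 - alpha / s] at each step,
    and [1 - alpha / s <= expR (- (alpha / s))]. Replacing the power by the
    exponential goes in the right direction only if [Y <= 0]; otherwise the bound
    is nonnegative while [f G <= 0]. *)
Lemma greedy_bound s r (S G : {set O}) : (0 < s)%N -> (#|S| <= s)%N ->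
  greedy_solution f r G ->
  f G <= (1 - expR (- (alpha * r%:R / s%:R))) * (f S + s%:R * eps).
Proof.
have [a0 a1] := andP alpha01.
move=> s0 Ss grG; set Y := f S + s%:R * eps.
have s0R : 0 < s%:R :> R by rewrite ltr0n.
pose q := 1 - alpha / s%:R.
have q0 : 0 <= q.
  by rewrite subr_ge0 ler_pdivrMr // mul1r (le_trans a1) // ler1n.
have fG0 r' G' : greedy_solution f r' G' -> f G' <= 0.
  by elim=> [|j G1 u _ IH _ _]; [rewrite f0 | apply: le_trans IH].
have decay : f G - Y <= q ^+ r * (- Y).
  elim: grG => [|j G1 u _ IH uG1 minu]; first by rewrite f0 expr0 mul1r sub0r.
  rewrite exprS -mulrA; apply: le_trans (ler_wpM2l q0 IH).
  have := greedy_step_seq (enum S) minu.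
  rewrite finset.set_enum -cardE.
  have g0 : 0 <= f G1 - f (u |: G1)%SET by rewrite subr_ge0.
  have fSG : f (S :|: G1) <= f S.
    by rewrite finset.setUC -(finset.set_enum G1) f_setU.
  have cs : #|S|%:R <= s%:R :> R by rewrite ler_nat.
  move=> step.
  have ae : 0 <= alpha * eps by rewrite mulr_ge0.
  have step' : alpha * (f G1 - Y) <= s%:R * (f G1 - f (u |: G1)%SET).
    have : #|S|%:R * (f G1 - f (u |: G1)%SET + alpha * eps)
           <= s%:R * (f G1 - f (u |: G1)%SET + alpha * eps).
      by apply: ler_wpM2r => //; apply: addr_ge0.
    have : alpha * f (S :|: G1) <= alpha * f S by apply: ler_wpM2l.
    rewrite /Y; move: step; set k := #|S|%:R; set g := f G1 - f (u |: G1)%SET => step.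
    by nra.
  have : alpha / s%:R * (f G1 - Y) <= f G1 - f (u |: G1)%SET.
    by rewrite mulrAC ler_pdivrMr // mulrC [leRHS]mulrC mulrC.
  by rewrite /q; set c := alpha / _; nra.
have qexp : q ^+ r <= expR (- (alpha * r%:R / s%:R)).
  have -> : - (alpha * r%:R / s%:R) = - (alpha / s%:R) * r%:R by rewrite mulrAC mulNr.
  by rewrite expRM_natr lerXn2r ?nnegrE ?expR_ge0 // expR_ge1Dx.
have e1 : expR (- (alpha * r%:R / s%:R)) <= 1.
  by rewrite expR_le1 oppr_le0 divr_ge0 ?mulr_ge0 ?ler0n.
have := fG0 _ _ grG; move: decay qexp e1.
set e := expR _; set t := q ^+ r => decay qexp e1 fG_le0.
have [Y0|Y0] := leP Y 0; nra.
Qed.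
End Greedy.

(** * Smoothing error covariances *)

Section Smoothing.
Context {R : realType} {n : nat} {O : finType} {p : O -> nat}.
Variables (F : 'M[R]_n) (H : forall u : O, 'M[R]_(p u, n)).
Variables (Pi0 Rw : 'M[R]_n) (Rv : forall u : O, 'M[R]_(p u)).
Hypothesis n_gt0 : (0 < n)%N.
Hypothesis Pi0_posdef : posdef Pi0.
Hypothesis Rw_posdef : posdef Rw.
Hypothesis Rv_posdef : forall u : O, posdef (Rv u).
Implicit Types (A B X : {set O}) (u : O) (k m : nat).

Local Notation C := (prior_cov Pi0 Rw).
Local Notation info := (smoothing_info F H Rv).
Local Notation cov := (smoothing_cov F H Pi0 Rw Rv).
Local Notation ell := (ell_max Pi0 Rw).
Local Notation precision k X := (invmx (C k) + info k X).

Lemma trajectory_dim_gt0 k : (0 < \sum_(i < k.+1) n)%N.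
Proof. by rewrite sum_nat_const card_ord muln_gt0. Qed.

Lemma prior_cov_posdef k : posdef (C k).
Proof. by apply: posdef_mxdiag => i; case: eqP. Qed.

Lemma ell_max_gt0 : 0 < ell.
Proof. by rewrite /ell_max lt_max lambda_max_gt0. Qed.

Lemma prior_cov_le k : C k ≼ ell%:M.
Proof.
apply: mxdiag_loewner_scalar => i.
have le_block (B : 'M[R]_n) : posdef B -> lambda_max B <= ell -> B ≼ ell%:M.
  move=> pB lB; apply: loewner_trans (loewner_scalar lB).
  exact/loewner_lambda_max/posdef_psd.
by case: eqP => _; apply: le_block => //; rewrite /ell_max le_max lexx ?orbT.
Qed.

Lemma inv_prior_cov_ge k : (ell^-1)%:M ≼ invmx (C k).
Proof.
by rewrite -invmx_scalar; apply: loewner_inv (prior_cov_posdef k) (prior_cov_le k).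
Qed.

Lemma smoothing_info_psd k X : psd (info k X).
Proof.
apply: psd_sum => u _; apply: psd_congr; apply: psd_mxdiag => i.
exact/psd_congr/posdef_psd/posdef_inv.
Qed.

Lemma smoothing_infoU1 k u X : u \notin X ->
  info k (u |: X)%SET = info k X + info k [set u]%SET.
Proof. by move=> uX; rewrite /smoothing_info big_setU1 // big_set1 addrC. Qed.

Lemma smoothing_info_mono k A B : A \subset B -> info k A ≼ info k B.
Proof.
move=> AB; rewrite {2}/smoothing_info (big_setID A) /= (finset.setIidPr AB).
exact/loewner_addr/smoothing_info_psd.
Qed.

Lemma precision_posdef k X : posdef (precision k X).
Proof.
exact: posdefD (posdef_inv (prior_cov_posdef k)) (smoothing_info_psd k X).
Qed.

Lemma precision_mono k A B : A \subset B -> precision k A ≼ precision k B.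
Proof.
move=> AB; apply: loewner_add (smoothing_info_mono k AB).
by rewrite /loewner subrr; exact: psd0.
Qed.

Lemma precisionU1 k u X : u \notin X ->
  precision k (u |: X)%SET = precision k X + info k [set u]%SET.
Proof. by move=> uX; rewrite smoothing_infoU1 // addrA. Qed.

Lemma precision_ge k X : (ell^-1)%:M ≼ precision k X.
Proof.
exact: loewner_trans (inv_prior_cov_ge k) (loewner_addr _ (smoothing_info_psd k X)).
Qed.

Lemma smoothing_cov_posdef k X : posdef (cov k X).
Proof. exact/posdef_inv/precision_posdef. Qed.

Lemma smoothing_cov_le k X : cov k X ≼ ell%:M.
Proof.
rewrite -[ell]invrK -invmx_scalar; apply: loewner_inv (precision_ge k X).
by apply: posdef_scalar; rewrite invr_gt0 ell_max_gt0.
Qed.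

Lemma smoothing_cov_anti k A B : A \subset B -> cov k B ≼ cov k A.
Proof. by move=> AB; apply: loewner_inv (precision_posdef k A) (precision_mono k AB). Qed.

Lemma smoothing_cov0 k : cov k finset.set0 = C k.
Proof. by rewrite /smoothing_cov /smoothing_info big_set0 addr0 invmxK. Qed.

Lemma precision_max_gt0 k : 0 < lambda_max (precision k [set: O]%SET).
Proof.
by apply: (lambda_max_gt0 (trajectory_dim_gt0 k)); exact: precision_posdef.
Qed.

Lemma alpha_tilde_itv m k : 0 <= alpha_tilde F H Pi0 Rw Rv m k <= 1.
Proof.
rewrite /alpha_tilde; have L0 := precision_max_gt0 (m + k).
rewrite ler_pdivrMr // mul1r; apply/andP; split.
  by rewrite divr_ge0 ?invr_ge0 ?(ltW L0) // (ltW ell_max_gt0).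
apply: lambda_max_ge (precision_ge _ _); first exact: trajectory_dim_gt0.
exact/posdef_psd/precision_posdef.
Qed.

(** The information matrix of every set lies between [ell^-1%:M], by the prior, and
    the largest eigenvalue of the information matrix of all the sensors; the ratio
    of these two bounds is [alpha_tilde]. *)
Lemma trace_cov_gain m k A B u : A \subset B -> u \notin B ->
  alpha_tilde F H Pi0 Rw Rv m k *
    (\tr (cov (m + k) B) - \tr (cov (m + k) (u |: B)%SET))
  <= \tr (cov (m + k) A) - \tr (cov (m + k) (u |: A)%SET).
Proof.
move=> AB uB; have uA : u \notin A by apply: contra uB; exact: (fintype.subsetP AB).
rewrite /smoothing_cov !precisionU1 // /alpha_tilde mulrAC.
rewrite ler_pdivrMr ?precision_max_gt0 // [leRHS]mulrC.
apply: trace_gain (precision_ge _ _).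
- exact: precision_posdef.
- exact: precision_mono.
- exact: smoothing_info_psd.
- apply: loewner_trans (precision_mono _ (finset.subsetT A)) _.
  apply: (loewner_lambda_max (trajectory_dim_gt0 (m + k))).
  exact/posdef_psd/precision_posdef.
Qed.

Lemma spectral_norm_cov k X : spectral_norm (cov k X) = lambda_max (cov k X).
Proof.
by apply: (spectral_norm_posdef (trajectory_dim_gt0 k)); exact: smoothing_cov_posdef.
Qed.

Lemma spectral_norm_cov_anti k A B :
  A \subset B -> spectral_norm (cov k B) <= spectral_norm (cov k A).
Proof.
move=> AB; have pcov X := posdef_psd (smoothing_cov_posdef k X).
rewrite !spectral_norm_cov; apply: (lambda_max_le (trajectory_dim_gt0 k)) => //.
apply: loewner_trans (smoothing_cov_anti k AB) _.
exact: (loewner_lambda_max (trajectory_dim_gt0 k) (pcov _)).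
Qed.

Lemma epsilon_tilde_ge0 m k : 0 <= epsilon_tilde F H Pi0 Rw Rv m k.
Proof.
apply: mulr_ge0 (sqr_ge0 _).
by apply: (lambda_max_ge0 (trajectory_dim_gt0 (m + k))); exact: smoothing_info_psd.
Qed.

(** The update by one sensor is dominated by that of all the sensors, and the
    covariance by [ell%:M]; these are the two factors of [epsilon_tilde]. *)
Lemma norm_cov_gain m k B u : u \notin B ->
  spectral_norm (cov (m + k) B) - spectral_norm (cov (m + k) (u |: B)%SET)
    <= epsilon_tilde F H Pi0 Rw Rv m k.
Proof.
move=> uB; have dim := trajectory_dim_gt0 (m + k).
have pcov X := posdef_psd (smoothing_cov_posdef (m + k) X).
rewrite !spectral_norm_cov lerBlDl; apply: lambda_max_le => //.
have info_le : info (m + k) [set u]%SET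
    ≼ (lambda_max (info (m + k) [set: O]%SET))%:M.
  apply: loewner_trans (smoothing_info_mono _ (finset.subsetT _)) _.
  by apply: (loewner_lambda_max dim); exact: smoothing_info_psd.
have step : cov (m + k) B
    ≼ cov (m + k) (u |: B)%SET + (epsilon_tilde F H Pi0 Rw Rv m k)%:M.
  rewrite /smoothing_cov precisionU1 //; apply: inv_loewner_add info_le _ _ _.
  - exact: precision_posdef.
  - exact: smoothing_info_psd.
  - by apply: (lambda_max_ge0 dim); exact: smoothing_info_psd.
  - exact: ell_max_gt0.
  - exact: smoothing_cov_le.
apply: loewner_trans step _; rewrite raddfD /=.
apply: (loewner_add (loewner_lambda_max dim (pcov _))).
by rewrite /loewner subrr; exact: psd0.
Qed.

(** * Gains of the two objectives *)

Section Objectives.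
Variables (N m : nat) (theta : 'I_N -> R).
Hypothesis theta_ge0 : forall k : 'I_N, 0 <= theta k.

Local Notation f_T := (trace_objective F H Pi0 Rw Rv m theta).
Local Notation f_S := (norm_objective F H Pi0 Rw Rv m theta).

Lemma trace_objectiveB A B : f_T A - f_T B =
  \sum_(k < N) theta k * (\tr (cov (m + k) A) - \tr (cov (m + k) B)).
Proof.
rewrite -sumrB; apply: eq_bigr => k _; rewrite -mulrBr; congr (_ * _).
by rewrite opprB addrA subrK.
Qed.

Lemma norm_objectiveB A B : f_S A - f_S B =
  \sum_(k < N) theta k *
    (spectral_norm (cov (m + k) A) - spectral_norm (cov (m + k) B)).
Proof.
rewrite -sumrB; apply: eq_bigr => k _; rewrite -mulrBr; congr (_ * _).
by rewrite opprB addrA subrK.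
Qed.

Lemma trace_objective0 : f_T finset.set0 = 0.
Proof. by apply: big1 => k _; rewrite smoothing_cov0 subrr mulr0. Qed.

Lemma norm_objective0 : f_S finset.set0 = 0.
Proof. by apply: big1 => k _; rewrite smoothing_cov0 subrr mulr0. Qed.

Lemma trace_objective_anti A u : f_T (u |: A)%SET <= f_T A.
Proof.
rewrite -subr_ge0 trace_objectiveB sumr_ge0 // => k _; rewrite mulr_ge0 // subr_ge0.
exact/mxtrace_loewner/smoothing_cov_anti/finset.subsetUr.
Qed.

Lemma norm_objective_anti A u : f_S (u |: A)%SET <= f_S A.
Proof.
rewrite -subr_ge0 norm_objectiveB sumr_ge0 // => k _; rewrite mulr_ge0 // subr_ge0.
exact/spectral_norm_cov_anti/finset.subsetUr.
Qed.

Lemma min_alpha_tilde_itv : 0 <= min_alpha_tilde F H Pi0 Rw Rv m N <= 1.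
Proof.
apply/andP; split.
  apply: le_bigmin => [|k _]; first by case/andP: (alpha_tilde_itv m 0).
  by case/andP: (alpha_tilde_itv m k).
by apply: le_trans (bigmin_le_id _ _ _ _) _; case/andP: (alpha_tilde_itv m 0).
Qed.

Lemma trace_objective_gain A B u : A \subset B -> u \notin B ->
  min_alpha_tilde F H Pi0 Rw Rv m N * (f_T B - f_T (u |: B)%SET - 0)
    <= f_T A - f_T (u |: A)%SET.
Proof.
move=> AB uB; rewrite subr0 !trace_objectiveB mulr_sumr; apply: ler_sum => k _.
rewrite mulrCA; apply: ler_wpM2l => //.
apply: le_trans (trace_cov_gain m k AB uB); apply: ler_wpM2r; last exact: bigmin_le.
rewrite subr_ge0; exact/mxtrace_loewner/smoothing_cov_anti/finset.subsetUr.
Qed.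

(** The right-hand side is nonnegative and the left-hand side nonpositive: the
    defect [eps] absorbs the whole gain at [B]. *)
Lemma norm_objective_gain A B u : A \subset B -> u \notin B ->
  1 * (f_S B - f_S (u |: B)%SET
       - \sum_(k < N) theta k * epsilon_tilde F H Pi0 Rw Rv m k)
    <= f_S A - f_S (u |: A)%SET.
Proof.
move=> _ uB; rewrite mul1r; apply: (@le_trans _ _ 0); last first.
  by rewrite subr_ge0 norm_objective_anti.
rewrite subr_le0 norm_objectiveB; apply: ler_sum => k _.
by apply: ler_wpM2l => //; apply: norm_cov_gain.
Qed.

End Objectives.
End Smoothing.

(** * Guarantee for the greedy selections *)

Theorem theorem6 (R : realType) (n : nat) (O : finType) (p : O -> nat)
    (F : 'M[R]_n) (H : forall u : O, 'M[R]_(p u, n))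
    (Pi0 Rw : 'M[R]_n) (Rv : forall u : O, 'M[R]_(p u))
    (N m : nat) (theta : 'I_N -> R) (s r : nat)
    (n_gt0 : (0 < n)%N)
    (Pi0_posdef : posdef Pi0)
    (Rw_posdef : posdef Rw)
    (Rv_posdef : forall u : O, posdef (Rv u))
    (N_ge1 : (1 <= N)%N)
    (theta_ge0 : forall k : 'I_N, 0 <= theta k)
    (s_ge1 : (1 <= s)%N)
    (r_le : (r <= #|O|)%N) :
  let f_T := trace_objective F H Pi0 Rw Rv m theta in
  let f_S := norm_objective F H Pi0 Rw Rv m theta in
  exists alpha eps : R,
    [/\ min_alpha_tilde F H Pi0 Rw Rv m N <= alpha,
        eps <= \sum_(k < N) theta k * epsilon_tilde F H Pi0 Rw Rv m k,
        forall T_star T_g : {set O},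
          budget_argmin f_T s T_star ->
          greedy_solution f_T r T_g ->
          f_T T_g <= (1 - expR (- (alpha * r%:R / s%:R))) * f_T T_star
      & forall S_star S_g : {set O},
          budget_argmin f_S s S_star ->
          greedy_solution f_S r S_g ->
          f_S S_g <= (1 - expR (- (r%:R / s%:R))) * (f_S S_star + s%:R * eps)].
Proof.
move=> f_T f_S.
exists (min_alpha_tilde F H Pi0 Rw Rv m N).
exists (\sum_(k < N) theta k * epsilon_tilde F H Pi0 Rw Rv m k).
split=> // [T_star T_g [T_le _] greedyT | S_star S_g [S_le _] greedyS].
  set alpha := min_alpha_tilde _ _ _ _ _ _ _.
  suff : f_T T_g <= (1 - expR (- (alpha * r%:R / s%:R))) * (f_T T_star + s%:R * 0).
    by rewrite mulr0 addr0.
  apply: greedy_bound s_ge1 T_le greedyT.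
  - exact: trace_objective0.
  - by move=> A u; apply: trace_objective_anti.
  - by move=> A B u; apply: trace_objective_gain.
  - exact: min_alpha_tilde_itv.
  - exact: lexx.
set eps := \sum_(k < N) _.
suff : f_S S_g <= (1 - expR (- (1 * r%:R / s%:R))) * (f_S S_star + s%:R * eps).
  by rewrite mul1r.
apply: greedy_bound s_ge1 S_le greedyS.
- exact: norm_objective0.
- by move=> A u; apply: norm_objective_anti.
- by move=> A B u; apply: norm_objective_gain.
- by rewrite ler01 lexx.
- by rewrite sumr_ge0 // => k _; rewrite mulr_ge0 // epsilon_tilde_ge0.
Qed.
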